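(* For any integer $q \ge 1$, any interval $\mathcal{J} = \{L+1, \ldots, L+N\} \subseteq [1,q-1]$ of $N$ consecutive integers, and any sequence of complex weights $\mathcal{A} = \{\alpha_m\}_{m \in \mathbb{Z}_q^*}$, the sum $$ \mathcal{S}_q(\mathcal{A};\mathcal{J}) = \sum_{m\in \mathbb{Z}_q^*} \sum_{n \in \mathcal{J}} \alpha_m \mathcal{K}_q(m,n) $$ satisfies $$ \mathcal{S}_q(\mathcal{A};\mathcal{J}) \ll \left( \|\mathcal{A}\|_1 \|\mathcal{A}\|_2\right)^{1/2} \left(N^{1/8} q + N^{1/2} q^{3/4}\right) q^{o(1)}. $$
   Context: $\mathbb{Z}_q$ is the residue ring modulo $q$ and $\mathbb{Z}_q^*$ is its group of units. For integers $m,n$ the Kloosterman sum is $$ \mathcal{K}_q(m,n) = \sum_{x \in \mathbb{Z}_q^*} \mathbf{e}_q(mx + n\overline{x}), $$ where $\overline{x}$ is the multiplicative inverse of $x$ modulo $q$ and $\mathbf{e}_q(z) = \exp(2\pi i z/q)$. For $\sigma>0$, $\|\mathcal{A}\|_\sigma = \left(\sum_{m \in \mathbb{Z}_q^*} |\alpha_m|^\sigma\right)^{1/\sigma}$. $A \ll B$ means $|A| \le cB$ with a constant $c>0$, here absolute. The bound with $q^{o(1)}$ means: for every $\delta>0$ there is a constant $C(\delta)$, depending only on $\delta$, such that the bound holds with $q^{o(1)}$ replaced by $C(\delta) q^{\delta}$, uniformly over all $q$, $\mathcal{J}$ and $\mathcal{A}$. *)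

(* Defs.v *)
From mathcomp Require Import all_boot all_order all_algebra.
From mathcomp Require Import reals exp trigo.
From mathcomp Require Export complex.

Set Implicit Arguments.
Unset Strict Implicit.
Unset Printing Implicit Defensive.

Import Order.TTheory GRing.Theory Num.Theory.
Local Open Scope ring_scope.
Local Open Scope complex_scope.

(* For q >= 1 we have q.-1.+1 = q. Unlike 'Z_q, whose carrier is
   {0, ..., max(q, 2) - 1}, this is also correct for q = 1. Its multiplication,
   unit element and inverse are Zp_mul, Zp1 and Zp_inv. *)
Notation Zmod q := 'I_q.-1.+1.

Definition Zunits (q : nat) : {set Zmod q} :=
  [set x | [exists y, Zp_mul x y == Zp1]].

Lemma in_Zunits (q : nat) (x : Zmod q) : (0 < q)%N ->
  (x \in Zunits q) = coprime q x.
Proof.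
case: q x => // p x _; rewrite inE /=.
apply/existsP/idP => [[y /eqP/(congr1 val) /= xy1]|xp].
  have: coprime p.+1 (x * y).
    by rewrite -coprime_modr xy1 coprime_modr coprimen1.
  by rewrite coprimeMr => /andP[].
by exists (Zp_inv x); rewrite Zp_mulzV.
Qed.

Lemma Zunits_mulV (q : nat) (x : Zmod q) : (0 < q)%N ->
  x \in Zunits q -> Zp_mul x (Zp_inv x) = Zp1.
Proof.
by case: q x => // p x _; rewrite in_Zunits // => xp; rewrite Zp_mulzV.
Qed.

(* exp(2 pi i z / q), through exp(i t) = cos t + i sin t. *)
Definition e_q (R : realType) (q : nat) (z : int) : R[i] :=
  let t : R := 2 * pi * z%:~R / q%:R in cos t +i* sin t.

(* The residues x and Zp_inv x enter through their representatives in
   {0, ..., q - 1}; e_q is q-periodic, so the choice is immaterial. *)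
Definition kloosterman (R : realType) (q : nat) (m n : int) : R[i] :=
  \sum_(x in Zunits q)
    e_q R q (m * (x : nat)%:Z + n * (Zp_inv x : nat)%:Z).

(* Only the values of alpha on Zunits q are used, here and in bilinear_sum. *)
Definition weight_norm (R : realType) (q : nat) (sigma : R)
    (alpha : Zmod q -> R[i]) : R :=
  (\sum_(m in Zunits q) Normc.normc (alpha m) `^ sigma) `^ sigma^-1.

Definition bilinear_sum (R : realType) (q : nat) (alpha : Zmod q -> R[i])
    (L N : nat) : R[i] :=
  \sum_(m in Zunits q) \sum_(L.+1 <= n < (L + N).+1)
    alpha m * kloosterman R q (m : nat)%:Z n%:Z.

(* Main.v *)
Require Import Defs.
From mathcomp Require Import all_boot all_order all_algebra.
From mathcomp Require Import reals exp trigo.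
From mathcomp Require Import zify ring lra.

Import Order.TTheory GRing.Theory Num.Theory.
Local Open Scope ring_scope.
Local Open Scope complex_scope.

(* Opening the Kloosterman sums, the inner sum over n is a geometric sum of size
   at most min(N, 2q/|u|), where u is the least signed residue of the inverse of
   x. On a dyadic shell |u| ~ Z, two applications of Cauchy-Schwarz reduce the
   problem to the fourth moment over m of the exponential sum over x, that is, to
   the number of solutions of 1/u1 + 1/u2 = 1/u3 + 1/u4 modulo q with |ui| <= Z.
   Following Heath-Brown, this is at most q^o(1) (Z^2 + Z^(7/2) q^(-1/2)): given
   c, a Dirichlet approximation t c = r (mod q) turns 1/u1 + 1/u2 = c into
   (r u1 - t)(r u2 - t) = t^2 - k q r with few values of k, and the divisor bound
   applies. For composite q a loss of gcd(c, q) appears, but gcd(c, q) divides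
   u1 + u2, so it is harmless on average. *)

(** * The divisor bound *)

(** A divisor [d] of [m * n] is the product of [gcdn d m] and [d %/ gcdn d m], and the latter
    divides [n] by Gauss's lemma. *)
Lemma size_divisorsM (m n : nat) : (0 < m)%N -> (0 < n)%N ->
  (size (divisors (m * n)) <= size (divisors m) * size (divisors n))%N.
Proof.
move=> m0 n0; rewrite -(size_allpairs muln).
apply: uniq_leq_size (divisors_uniq _) _ => d.
rewrite -dvdn_divisors ?muln_gt0 ?m0 // => dmn.
have d0 : (0 < d)%N by apply: dvdn_gt0 dmn; rewrite muln_gt0 m0.
have g0 : (0 < gcdn d m)%N by rewrite gcdn_gt0 d0.
apply/allpairsP; exists (gcdn d m, d %/ gcdn d m)%N; split => /=.
- by rewrite -dvdn_divisors // dvdn_gcdr.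
- rewrite -dvdn_divisors //.
  have cop : coprime (d %/ gcdn d m) (m %/ gcdn d m).
    rewrite /coprime -(eqn_pmul2l g0) muln1 muln_gcdr.
    by rewrite !(mulnC (gcdn d m)) !divnK ?dvdn_gcdl ?dvdn_gcdr.
  rewrite -(Gauss_dvdr _ cop) -(dvdn_pmul2l g0) mulnA.
  by rewrite !(mulnC (gcdn d m)) !divnK ?dvdn_gcdl ?dvdn_gcdr.
- by rewrite mulnC divnK // dvdn_gcdl.
Qed.

Lemma size_divisors_pfactor (p e : nat) : prime p ->
  (size (divisors (p ^ e)) <= e.+1)%N.
Proof.
move=> pp.
suff : (size (divisors (p ^ e)) <= size [seq (p ^ i)%N | i <- iota 0 e.+1])%N.
  by rewrite size_map size_iota.
apply: uniq_leq_size (divisors_uniq _) _ => d.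
rewrite -dvdn_divisors ?expn_gt0 ?prime_gt0 // => /(dvdn_pfactor _ _ pp)[m me ->].
by apply: map_f; rewrite mem_iota.
Qed.

(** Raise [e + 1 <= k (e %/ k + 1) <= k 2^(e %/ k)] to the power [k]. This serves for exponents of
    primes and again for logarithms. *)
Lemma succn_expn_le (k e : nat) : (0 < k)%N -> (e.+1 ^ k <= k ^ k * 2 ^ e)%N.
Proof.
move=> k0; have {1}-> : e = (e %/ k * k + e %% k)%N by apply: divn_eq.
apply: (@leq_trans ((k * 2 ^ (e %/ k)) ^ k)).
  rewrite leq_exp2r //.
  have := ltn_expl (e %/ k) (ltnSn 1); have := ltn_pmod e k0.
  by move=> h1 h2; nia.
rewrite expnMn leq_mul2l -expnM; apply/orP; right.
by rewrite leq_pexp2l // leq_divM.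
Qed.

(** Induction on [M], splitting off the exact power [M^e] in [n] when [M] is prime. A prime below
    [2^k] costs a factor [k^k]; a prime [M >= 2^k] costs nothing, as [(e + 1)^k <= 2^(e k) <= M^e].
    This caps the exponent at [2^k], independently of [n]. *)
Lemma divisor_bound_smooth (k M n : nat) : (0 < k)%N -> (0 < n)%N ->
  (forall p, prime p -> (p %| n)%N -> (p < M)%N) ->
  (size (divisors n) ^ k <= (k ^ k) ^ minn M (2 ^ k) * n)%N.
Proof.
move=> k0; elim: M n => [|M IH] n n0 hn.
  case: (ltnP 1 n) => n1; last first.
    have -> : n = 1%N by lia.
    by rewrite exp1n min0n.
  by have := hn _ (pdiv_prime n1) (pdiv_dvd n).
have kk0 : (0 < k ^ k)%N by rewrite expn_gt0 k0.
have [Mp|MNp] := boolP (prime M); last first.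
  apply: leq_trans (IH n n0 _) _ => [p pp pn|].
    have := hn p pp pn; rewrite ltnS leq_eqVlt => /orP[/eqP pM|//].
    by rewrite -pM pp in MNp.
  by rewrite leq_mul2r leq_pexp2l ?orbT //; lia.
set m := (n`_M^')%N; have m0 : (0 < m)%N by apply: part_gt0.
have nE : n = (M ^ logn M n * m)%N by rewrite -p_part partnC.
have M1 := prime_gt1 Mp.
have {}IH : (size (divisors m) ^ k <= (k ^ k) ^ minn M (2 ^ k) * m)%N.
  apply: IH => // p pp pm; have := hn p pp (dvdn_trans pm (dvdn_part _ _)).
  rewrite ltnS leq_eqVlt => /orP[/eqP pM|//].
  have : p \in \pi(m) by rewrite mem_primes pp m0 pm.
  by move/(pnatPpi (part_pnat _ _)); rewrite pM !inE eqxx.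
rewrite {1}nE.
apply: (@leq_trans ((logn M n).+1 ^ k * size (divisors m) ^ k)).
  rewrite -expnMn leq_exp2r //.
  apply: leq_trans (size_divisorsM _ _ _ m0) _; first by rewrite expn_gt0; lia.
  by rewrite leq_mul2r size_divisors_pfactor ?orbT.
set e := logn M n in nE *.
have [Mk|Mk] := ltnP M (2 ^ k).
  have -> : minn M.+1 (2 ^ k) = (minn M (2 ^ k)).+1 by lia.
  rewrite nE expnS.
  have h1 := succn_expn_le k e k0.
  have h2 : (2 ^ e <= M ^ e)%N by case: (e) => // e'; rewrite leq_exp2r.
  have h3 : (e.+1 ^ k <= k ^ k * M ^ e)%N by apply: leq_trans h1 _; rewrite leq_mul2l h2 orbT.
  apply: leq_trans (leq_mul h3 IH) _; rewrite leq_eqVlt; apply/orP; left; apply/eqP; ring.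
have -> : minn M.+1 (2 ^ k) = minn M (2 ^ k) by lia.
have h3 : (e.+1 ^ k <= M ^ e)%N.
  apply: (@leq_trans ((2 ^ e) ^ k)); first by rewrite leq_exp2r // ltn_expl.
  rewrite -expnM mulnC expnM; case: (e) => // e'; by rewrite leq_exp2r.
rewrite nE; apply: leq_trans (leq_mul h3 IH) _.
by rewrite leq_eqVlt; apply/orP; left; apply/eqP; ring.
Qed.

Lemma divisor_bound (k n : nat) : (0 < k)%N -> (0 < n)%N ->
  (size (divisors n) ^ k <= (k ^ k) ^ (2 ^ k) * n)%N.
Proof.
move=> k0 n0; apply: leq_trans (divisor_bound_smooth k n.+1 n k0 n0 _) _.
  by move=> p _ pn; rewrite ltnS dvdn_leq.
by rewrite leq_mul2r leq_pexp2l ?geq_minr ?orbT // expn_gt0 k0.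
Qed.

(** * Dirichlet approximation and averages of gcds *)

(** Pigeonhole: two of the [T + 1] residues of [0, c, ..., T c] modulo [q] share one of [T] boxes of
    length [q / T]; subtract them. *)
Lemma dirichlet_approximation (q c T : nat) : (0 < q)%N -> (0 < T)%N ->
  exists (t : nat) (r : int),
    [/\ (0 < t <= T)%N, (`|r| * T <= q)%N & (q %| t%:Z * c%:Z - r)%Z].
Proof.
move=> q0 T0.
have box (t : nat) : ((t * c %% q * T) %/ q < T)%N.
  by rewrite ltn_divLR // mulnC ltn_pmul2l // ltn_pmod.
pose f (t : 'I_T.+1) : 'I_T := Ordinal (box t).
have /injectivePn [t1 [t2 t12 /(congr1 val) /= ft]] : ~~ injectiveb f.
  by apply/negP => /injectiveP/leq_card; rewrite !card_ord ltnn.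
wlog lt12 : t1 t2 t12 ft / (t1 < t2)%N.
  move=> H; case: (ltngtP t1 t2) => h; first exact: (H t1 t2).
    by apply: (H t2 t1) => //; rewrite eq_sym.
  by move: t12; rewrite (ord_inj h) eqxx.
exists (t2 - t1)%N, ((t2 * c %% q)%N%:Z - (t1 * c %% q)%N%:Z); split.
- have := ltn_ord t2; lia.
- set x := (t1 * c %% q)%N in ft *; set y := (t2 * c %% q)%N in ft *.
  have h1 := divn_eq (x * T) q; have h2 := divn_eq (y * T) q.
  have h3 := ltn_pmod (x * T) q0; have h4 := ltn_pmod (y * T) q0.
  rewrite ft in h1; nia.
- have h1 := divn_eq (t1 * c) q; have h2 := divn_eq (t2 * c) q.
  apply/dvdzP; exists ((t2 * c %/ q)%N%:Z - (t1 * c %/ q)%N%:Z).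
  move: h1 h2; move: (t1 * c %/ q)%N (t1 * c %% q)%N (t2 * c %/ q)%N (t2 * c %% q)%N.
  by move=> a b a' b' h1 h2; nia.
Qed.

(** [gcdn s q] is one of the divisors [g] of [q] that divide [s], so it is at most their sum. After
    exchanging sums, each [g] contributes [g * (Y %/ g) <= Y]. *)
Lemma sum_gcdn_le (q Y : nat) : (0 < q)%N ->
  (\sum_(1 <= s < Y.+1) gcdn s q <= size (divisors q) * Y)%N.
Proof.
move=> q0.
have H s : (0 < s)%N -> (gcdn s q <= \sum_(g <- divisors q | g %| s) g)%N.
  move=> s0; rewrite (big_rem (gcdn s q)) /= ?dvdn_gcdl ?leq_addr //.
  by rewrite -dvdn_divisors // dvdn_gcdr.
apply: (@leq_trans (\sum_(1 <= s < Y.+1) \sum_(g <- divisors q | g %| s) g)%N).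
  rewrite big_seq [X in (_ <= X)%N]big_seq; apply: leq_sum => s.
  by rewrite mem_index_iota => /andP[s0 _]; apply: H.
rewrite (exchange_big_dep xpredT) //= -sum1_size big_distrl /= big_seq.
rewrite [X in (_ <= X)%N]big_seq; apply: leq_sum => g.
rewrite -dvdn_divisors // => gq; have g0 := dvdn_gt0 q0 gq.
have -> : (\sum_(1 <= i < Y.+1 | (g %| i)%N) g = g * (Y %/ g))%N.
  rewrite divn_count_dvd big_distrr /= big_mkcond; apply: eq_bigr => i _.
  by case: (_ %| _)%N; rewrite ?muln1 ?muln0.
by rewrite mul1n mulnC leq_divM.
Qed.

(** * Solutions of [1/u1 + 1/u2 = c] modulo [q] *)

Lemma small_dvdz_inj (q a b : nat) : (a < q)%N -> (b < q)%N ->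
  (q %| a%:Z - b%:Z)%Z -> a = b.
Proof.
move=> aq bq; rewrite -eqz_mod_dvd !modz_nat !modn_small //.
by move=> /eqP[].
Qed.

Lemma abszD_le (a b : int) : (`|(a + b)%R| <= `|a| + `|b|)%N.
Proof. lia. Qed.

Lemma abszB_le (a b : int) : (`|(a - b)%R| <= `|a| + `|b|)%N.
Proof. lia. Qed.

(** Multiply [t (x + y) = r] by [u1 u2], where [x] and [y] are the inverses of [u1] and [u2] modulo
    [q]. *)
Lemma reciprocal_relation (q t r c x y u1 u2 : int) :
  (q %| x * u1 - 1)%Z -> (q %| y * u2 - 1)%Z -> (q %| x + y - c)%Z ->
  (q %| t * c - r)%Z -> (q %| t * (u1 + u2) - r * u1 * u2)%Z.
Proof.
move=> /dvdzP[a ha] /dvdzP[b hb] /dvdzP[d hd] /dvdzP[l hl]; apply/dvdzP.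
exists (t * d * u1 * u2 + l * u1 * u2 - t * (u2 * a + u1 * b)).
have -> : (t * d * u1 * u2 + l * u1 * u2 - t * (u2 * a + u1 * b)) * q
  = t * (d * q) * u1 * u2 + (l * q) * u1 * u2 - t * (u2 * (a * q) + u1 * (b * q)).
  ring.
by rewrite -ha -hb -hd -hl; ring.
Qed.

(** If [r u1 = t], then modulo [q] both [r = t x] and [r = t c = t x + t y]. So [t y = 0], hence
    [t = 0] since [y] is a unit, and then [r = 0]. *)
Lemma reciprocal_neq (q t r c x y u1 u2 : int) :
  (q %| x * u1 - 1)%Z -> (q %| y * u2 - 1)%Z -> (q %| x + y - c)%Z ->
  (q %| t * c - r)%Z -> ~~ (q %| r)%Z -> r * u1 - t != 0.
Proof.
move=> /dvdzP[a ha] /dvdzP[b hb] /dvdzP[d hd] /dvdzP[l hl].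
apply: contraNneq => e0.
have ru : r * u1 = t by apply/eqP; rewrite -subr_eq0 e0.
pose w := u2 * (l + t * d - r * a) - t * b.
have tE : t = w * q.
  have -> : w * q = u2 * (l * q + t * (d * q) - r * (a * q)) - t * (b * q).
    by rewrite /w; ring.
  by rewrite -hl -hd -ha -hb -ru; ring.
apply/dvdzP; exists (w * x - r * a).
have -> : (w * x - r * a) * q = x * (w * q) - r * (a * q) by ring.
by rewrite -tE -ru -ha; ring.
Qed.

Lemma inverse_unique (q x y u : int) :
  (q %| x * u - 1)%Z -> (q %| y * u - 1)%Z -> (q %| x - y)%Z.
Proof.
move=> /dvdzP[a ha] /dvdzP[b hb]; apply/dvdzP; exists (y * a - x * b).
have -> : (y * a - x * b) * q = y * (a * q) - x * (b * q) by ring.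
by rewrite -ha -hb; ring.
Qed.

(* With [t c = r] modulo [q = p.+1], the relation [1/u1 + 1/u2 = c] becomes
   [t (u1 + u2) - r u1 u2 = k q] with few possible [k], and then
   [(r u1 - t) (r u2 - t) = t ^ 2 - k q r], which is nonzero since [q] does not
   divide [r]; so [r u1 - t] is a divisor of a known nonzero integer. *)
Lemma card_reciprocal_fiber (p : nat) (P : {pred 'I_p.+1})
    (u : 'I_p.+1 -> int) (Z t K D : nat) (c : 'I_p.+1) (r : int) :
  (forall x, P x -> (p.+1 %| (x : nat)%:Z * u x - 1)%Z) ->
  (forall x, P x -> (`|u x| <= Z)%N) ->
  (p.+1 %| t%:Z * (c : nat)%:Z - r)%Z -> ~~ (p.+1 %| r)%Z ->
  (2 * t * Z + `|r| * Z ^ 2 < K.+1 * p.+1)%N ->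
  (forall n, (0 < n <= (`|r| * Z + t) ^ 2)%N -> (size (divisors n) <= D)%N) ->
  (#|[pred x | P x && P (c - x)%R]| <= (2 * K).+1 * (2 * D))%N.
Proof.
move=> uP uZ tc rN0 KZ hD; set q := p.+1 in uP tc rN0 KZ *.
pose e (x : 'I_q) : int := r * u x - t%:Z.
pose ks := [seq i%:Z - K%:Z | i <- iota 0 (2 * K).+1].
pose M (k : int) : int := t%:Z ^+ 2 - r * (k * q%:Z).
(* Candidates for [e x]: the signed divisors of [M k]. The list is empty when [M k] is zero or too
   large, which keeps its length at most [2 * D] for every [k]; a solution never meets these two
   cases. *)
pose dv (k : int) := if M k == 0 then [::] else
  if (`|M k| <= (`|r| * Z + t) ^ 2)%N then
  [seq d%:Z | d <- divisors `|M k|] ++ [seq - d%:Z | d <- divisors `|M k|]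
  else [::].
have r0 : r != 0 by apply: contraNneq rN0 => ->; rewrite dvdz0.
have einj : {in [pred x | P x && P (c - x)%R] &, injective e}.
  move=> x y /andP[Px _] /andP[Py _] /addIr/(mulfI r0) uxy.
  have xy := inverse_unique _ _ _ _ (uP x Px).
  rewrite uxy in xy; have {}xy := xy _ (uP y Py).
  exact/val_inj/(small_dvdz_inj _ _ _ (ltn_ord x) (ltn_ord y) xy).
have sz k : (size (dv k) <= 2 * D)%N.
  rewrite /dv; case: eqP => // Mk; case: ifP => // Mle.
  rewrite size_cat !size_map.
  have /hD : (0 < `|M k| <= (`|r| * Z + t) ^ 2)%N by rewrite absz_gt0 Mle; case: eqP Mk.
  by rewrite addnn -mul2n leq_mul2l.
apply: (@leq_trans (size (flatten [seq dv k | k <- ks]))); last first.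
  rewrite size_flatten /shape -map_comp sumnE big_map.
  apply: leq_trans (leq_sum _ (fun k _ => sz k)) _.
  by rewrite big_const_seq count_predT size_map size_iota iter_addn_0 mulnC.
rewrite cardE -(size_map e); apply: uniq_leq_size.
  rewrite map_inj_in_uniq ?enum_uniq // => x y; rewrite !mem_enum; exact: einj.
move=> z /mapP[x]; rewrite mem_enum => /andP[Px Py] ->.
set y := c - x in Py.
have ux := uZ x Px; have uy := uZ y Py.
have hd : (q %| (x : nat)%:Z + (y : nat)%:Z - (c : nat)%:Z)%Z.
  have <- : (val (x + y)) = c by rewrite /y addrC subrK.
  rewrite -eqz_mod_dvd -PoszD modz_nat.
  by rewrite modz_nat -/q modn_mod.
have /dvdzP[k kE] := reciprocal_relation _ _ _ _ _ _ _ _ (uP x Px) (uP y Py) hd tc.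
have e1N0 := reciprocal_neq _ _ _ _ _ _ _ _ (uP x Px) (uP y Py) hd tc rN0.
(* By symmetry in [x] and [y], the second factor is nonzero too. *)
rewrite [X in X - _]addrC in hd.
have e2N0 := reciprocal_neq _ _ _ _ _ _ _ _ (uP y Py) (uP x Px) hd tc rN0.
have eE : e x * (r * u y - t%:Z) = M k by rewrite /M -kE /e; ring.
have MN0 : M k != 0 by rewrite -eE mulf_neq0.
have Mle : (`|M k| <= (`|r| * Z + t) ^ 2)%N.
  rewrite -eE abszM -mulnn; apply: leq_mul.
    apply: leq_trans (abszB_le _ _) _; rewrite abszM leq_add ?leq_mul //.
  apply: leq_trans (abszB_le _ _) _; rewrite abszM leq_add ?leq_mul //.
(* [|k| q] is at most [2 t Z + |r| Z^2], which is below [(K + 1) q]. *)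
have kK : (`|k| <= K)%N.
  rewrite -ltnS -(ltn_pmul2r (ltn0Sn p)) -/q; apply: leq_ltn_trans KZ.
  have -> : (`|k| * q = `|(k * q%:Z)%R|)%N by rewrite abszM.
  rewrite -kE; apply: leq_trans (abszB_le _ _) _; rewrite !abszM.
  apply: leq_add.
    apply: (@leq_trans (t * (Z + Z))); last by rewrite addnn -mul2n mulnCA mulnA.
    by rewrite leq_mul //; apply: leq_trans (abszD_le _ _) _; rewrite leq_add.
  by rewrite -mulnA -mulnn !leq_mul.
apply/flattenP; exists (dv k).
  apply: map_f; apply/mapP; exists (absz (k + K%:Z)).
    by rewrite mem_iota; clear -kK; lia.
  by clear -kK; lia.
rewrite /dv (negPf MN0) Mle mem_cat.
have : (`|e x| \in divisors `|M k|)%N.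
  by rewrite -dvdn_divisors ?absz_gt0 // -eE abszM dvdn_mulr.
move=> ed; case: (ler0P (e x)) => es; apply/orP; [right|left]; apply/mapP;
  exists `|e x|%N => //; clear -es; move: (e x) es => v; lia.
Qed.

Lemma leq_sum_sub (T : eqType) (F : T -> nat) (s1 s2 : seq T) :
  uniq s1 -> {subset s1 <= s2} ->
  (\sum_(z <- s1) F z <= \sum_(z <- s2) F z)%N.
Proof.
elim: s1 s2 => [|z s1 IH] s2 /=; first by rewrite big_nil.
case/andP=> zs1 us1 sub.
have zs2 : z \in s2 by apply: sub; rewrite mem_head.
rewrite big_cons [X in (_ <= X)%N](big_rem _ zs2) /= leq_add2l; apply: IH => // x xs1.
have := sub x; rewrite inE xs1 orbT => /(_ isT).
rewrite (perm_mem (perm_to_rem zs2)) inE => /orP[/eqP xz|//].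
by rewrite -xz xs1 in zs1.
Qed.

Lemma leq_sum_inj (I : finType) (T : eqType) (P : {pred I}) (f : I -> T)
    (F : T -> nat) (s : seq T) :
  {in P &, injective f} -> (forall x, x \in P -> f x \in s) ->
  (\sum_(x in P) F (f x) <= \sum_(z <- s) F z)%N.
Proof.
move=> finj fs; rewrite -big_enum -(big_map f xpredT F) /=.
apply: leq_sum_sub.
  by rewrite map_inj_in_uniq ?enum_uniq // => x y; rewrite !mem_enum; apply: finj.
by move=> _ /mapP[x + ->]; rewrite mem_enum; apply: fs.
Qed.

(** Modulo [q], [u1 + u2 = u1 u2 (x + y) = u1 u2 c] with [u1 u2] a unit. It is applied to divisors
    of the modulus, so that [gcd(c, q)] divides [u1 + u2]. *)
Lemma reciprocal_sum_dvdz (q c x y u1 u2 : int) :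
  (q %| x * u1 - 1)%Z -> (q %| y * u2 - 1)%Z -> (q %| x + y - c)%Z ->
  (q %| u1 + u2)%Z = (q %| c)%Z.
Proof.
move=> /dvdzP[a ha] /dvdzP[b hb] /dvdzP[d hd].
have E : u1 + u2 = c * (u1 * u2) + (d * u1 * u2 - a * u2 - b * u1) * q.
  have -> : (d * u1 * u2 - a * u2 - b * u1) * q =
    (d * q) * u1 * u2 - (a * q) * u2 - (b * q) * u1 by ring.
  by rewrite -ha -hb -hd; ring.
rewrite E rpredDr; last by rewrite dvdz_mull.
apply/idP/idP => [|h]; last exact: dvdz_mulr.
move=> /dvdzP[k hk]; apply/dvdzP.
exists (k * x * y - c * (a * (b * q + 1) + b)).
have -> : (k * x * y - c * (a * (b * q + 1) + b)) * q =
  x * y * (k * q) - c * ((a * q) * (b * q + 1) + b * q) by ring.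
by rewrite -hk -ha -hb; ring.
Qed.

Lemma exists_sqrtn (n : nat) : exists s, (s ^ 2 <= n < s.+1 ^ 2)%N.
Proof.
elim: n => [|n [s /andP[h1 h2]]]; first by exists 0%N.
have [h|h] := ltnP n.+1 (s.+1 ^ 2); first by exists s; rewrite h andbT leqW.
by exists s.+1; rewrite h /= (leq_ltn_trans h2) // ltn_exp2r.
Qed.

(* [s] is the integer square root of [Z q], the optimal Dirichlet parameter when
   [c] is coprime to [q]; the cap [d - 1] with [d = q / gcd(c, q)] is what keeps
   [r = t c] nonzero modulo [q], at the cost of the factor [g = gcd(c, q)]. *)
Lemma dirichlet_parameter_balance (q g d s Z T r K : nat) :
  (0 < s)%N -> (Z <= s)%N -> (Z * q < s.+1 ^ 2)%N -> (q = g * d)%N -> (0 < g)%N ->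
  (1 < d)%N -> T = minn d.-1 s -> (r * T <= q)%N ->
  (K * q <= 2 * T * Z + r * Z ^ 2)%N ->
  (q * (2 * K).+1 <= 12 * g * (q + Z * s))%N.
Proof.
move=> s0 Zs qs qE g0 d1 TE rT Kq.
have Ts : (T <= s)%N by rewrite TE geq_minr.
have q0 : (0 < q)%N by rewrite qE muln_gt0 g0; lia.
have rZ : (r * Z ^ 2 <= 4 * g * (Z * s))%N.
  have [sd|sd] := leqP s d.-1.
    have TsE : T = s by rewrite TE; apply/minn_idPr.
    rewrite TsE in rT.
    (* As [s >= 1], [(s + 1)^2 <= 4 s^2]. *)
    have h1 : (Z * q <= 4 * s ^ 2)%N by nia.
    have h2 : (q * (r * Z ^ 2) <= q * (4 * (Z * s)))%N.
      apply: (@leq_trans (r * Z * (4 * s ^ 2))).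
        by rewrite [X in (X <= _)%N](_ : _ = r * Z * (Z * q))%N; [rewrite leq_mul2l h1 orbT|ring].
      rewrite [X in (X <= _)%N](_ : _ = (r * s) * (4 * (Z * s)))%N; last ring.
      by rewrite leq_mul2r rT orbT.
    rewrite leq_pmul2l // in h2; apply: leq_trans h2 _.
    by rewrite leq_mul2r leq_pmulr ?orbT.
  have TsE : T = d.-1 by rewrite TE; apply/minn_idPl/ltnW.
  rewrite TsE in rT.
  (* As [d > 1], [d <= 2 (d - 1)], so [d r <= 2 r T <= 2 q = 2 g d]. *)
  have h1 : (d * r <= d * (2 * g))%N by nia.
  rewrite leq_pmul2l in h1; last by lia.
  apply: (@leq_trans (2 * g * (Z * s))); last by rewrite !leq_mul.
  by rewrite leq_mul // -mulnn leq_mul2l Zs orbT.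
have h1 : (2 * T * Z <= 2 * g * (Z * s))%N.
  rewrite -!mulnA leq_mul2l /=; apply: (@leq_trans (Z * s)); last by rewrite leq_pmull.
  by rewrite mulnC leq_mul2l Ts orbT.
have h2 : (K * q <= 6 * (g * (Z * s)))%N.
  by apply: leq_trans Kq _; rewrite -!mulnA in h1 rZ; lia.
have h3 : (q <= g * q)%N by rewrite leq_pmull.
have -> : (12 * g * (q + Z * s) = 12 * (g * q) + 12 * (g * (Z * s)))%N by ring.
have -> : (q * (2 * K).+1 = 2 * (K * q) + q)%N by lia.
by lia.
Qed.

Lemma dvdz_ord_subr (p : nat) (x c : 'I_p.+1) :
  (p.+1 %| (x : nat)%:Z + ((c - x)%R : nat)%:Z - (c : nat)%:Z)%Z.
Proof.
have <- : (val (x + (c - x))) = c by rewrite addrC subrK.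
by rewrite -eqz_mod_dvd -PoszD !modz_nat modn_mod.
Qed.

(** Each of the [2 K + 1] possible [k] costs [2 D], and the balanced choice of [T] bounds
    [q (2 K + 1)] by [12 g (q + Z s)]. *)
Lemma reciprocal_fiber_bound (p : nat) (P : {pred 'I_p.+1})
    (u : 'I_p.+1 -> int) (Z s D : nat) (c : 'I_p.+1) :
  (forall x, P x -> (p.+1 %| (x : nat)%:Z * u x - 1)%Z) ->
  (forall x, P x -> (`|u x| <= Z)%N) ->
  (0 < Z <= p.+1)%N -> (s ^ 2 <= Z * p.+1 < s.+1 ^ 2)%N ->
  (forall n, (0 < n <= 4 * p.+1 ^ 4)%N -> (size (divisors n) <= D)%N) ->
  c != 0 ->
  (p.+1 * #|[pred x | P x && P (c - x)%R]|
     <= 24 * D * gcdn c p.+1 * (p.+1 + Z * s))%N.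
Proof.
move=> uP uZ /andP[Z0 Zq] /andP[sle slt] hD c0.
have q0 : (0 < p.+1)%N by [].
have cq : (c < p.+1)%N := ltn_ord c.
have {}c0 : (0 < c)%N by rewrite lt0n.
set g := gcdn c p.+1.
have g0 : (0 < g)%N by rewrite gcdn_gt0 c0.
have gle : (g <= c)%N by rewrite dvdn_leq // dvdn_gcdl.
pose d := (p.+1 %/ g)%N.
have qE : p.+1 = (g * d)%N by rewrite mulnC divnK // dvdn_gcdr.
have d1 : (1 < d)%N.
  rewrite -(ltn_pmul2l g0) muln1 -qE; exact: leq_ltn_trans cq.
have s0 : (0 < s)%N.
  by case: (s) slt => //; rewrite exp1n ltnS leqn0 muln_eq0 /= orbF => /eqP Z0'; rewrite Z0' in Z0.
have Zs : (Z <= s)%N.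
  rewrite -ltnS -(@ltn_exp2r _ _ 2) //; apply: leq_ltn_trans slt.
  by rewrite -mulnn leq_mul2l Zq orbT.
have sq : (s <= p.+1)%N.
  rewrite -(@leq_exp2r _ _ 2) //; apply: leq_trans sle _.
  by rewrite -mulnn leq_mul2r Zq orbT.
pose T := minn d.-1 s.
have T0 : (0 < T)%N by rewrite leq_min s0 andbT; case: (d) d1 => // [[]].
have Ts : (T <= s)%N by rewrite geq_minr.
have [t [r [/andP[t0 tT] rT tc]]] := dirichlet_approximation p.+1 c T q0 T0.
(* If [q] divides [r], it divides [t c], hence [t g]; then [d] divides [t], against
   [0 < t <= T <= d - 1]. *)
have rN0 : ~~ (p.+1 %| r)%Z.
  apply/negP => qr.
  have : (p.+1 %| t%:Z * (c : nat)%:Z)%Z by rewrite -(subrK r (t%:Z * _)) rpredD.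
  rewrite -PoszM dvdzE /= => qtc.
  have : (p.+1 %| t * g)%N by rewrite muln_gcdr dvdn_gcd qtc dvdn_mull.
  rewrite {1}qE mulnC dvdn_pmul2r // => /(dvdn_leq t0).
  have := leq_trans tT (geq_minl _ _); case: (d) d1 => // d' _ /= h1 h2.
  by have := leq_trans h2 h1; rewrite ltnn.
pose K := ((2 * t * Z + `|r| * Z ^ 2) %/ p.+1)%N.
have rq : (`|r| <= p.+1)%N by apply: leq_trans rT; rewrite leq_pmulr.
apply: (@leq_trans (p.+1 * ((2 * K).+1 * (2 * D)))).
  rewrite leq_mul2l /=; apply: (card_reciprocal_fiber p P u Z t K D c r) => //.
    exact: ltn_ceil.
  move=> n /andP[n0 nle]; apply: hD; rewrite n0 /=; apply: leq_trans nle _.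
  (* As [|r|], [Z] and [t] are at most [q], [|r| Z + t <= 2 q^2]; this is the origin of the range
     [4 q^4] for [D]. *)
  rewrite (_ : (4 * p.+1 ^ 4 = (2 * p.+1 ^ 2) ^ 2)%N); last by rewrite expnMn -expnM.
  rewrite leq_exp2r // mul2n -addnn leq_add //; first by rewrite -mulnn leq_mul.
  rewrite -mulnn; apply: leq_trans tT _; apply: leq_trans Ts _.
  by apply: leq_trans sq _; rewrite leq_pmulr.
have Kq : (K * p.+1 <= 2 * T * Z + `|r| * Z ^ 2)%N.
  apply: leq_trans (leq_divM _ _) _.
  by rewrite leq_add2r leq_mul2r leq_mul2l tT !orbT.
have H := dirichlet_parameter_balance p.+1 g d s Z T `|r| K s0 Zs slt qE g0 d1 erefl rT Kq.
rewrite mulnA; apply: leq_trans (leq_mul H (leqnn _)) _.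
by rewrite leq_eqVlt; apply/orP; left; apply/eqP; ring.
Qed.

(** * Additive energy of the reciprocals *)

(** The class [c = 0] is bounded trivially by [(3 Z)^2]. For [c != 0], one factor of the squared
    count takes the fiber bound and the other is opened as a sum over [x]; for fixed [x] the
    remaining sum of [gcd(c, q)] over [c] is small on average. *)
Lemma reciprocal_energy_bound (p : nat) (P : {pred 'I_p.+1})
    (u : 'I_p.+1 -> int) (Z s D : nat) :
  (forall x, P x -> (p.+1 %| (x : nat)%:Z * u x - 1)%Z) ->
  (forall x, P x -> (`|u x| <= Z)%N) ->
  (0 < Z <= p.+1)%N -> (s ^ 2 <= Z * p.+1 < s.+1 ^ 2)%N ->
  (forall n, (0 < n <= 4 * p.+1 ^ 4)%N -> (size (divisors n) <= D)%N) ->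
  (p.+1 * \sum_c #|[pred x | P x && P (c - x)%R]| ^ 2
     <= 300 * D ^ 2 * (Z ^ 2 * (p.+1 + Z * s)))%N.
Proof.
move=> uP uZ Zq sZ hD.
have Z0 : (0 < Z)%N by case/andP: Zq.
have D0 : (0 < D)%N by have := hD 1%N; apply; lia.
have uinj : {in P &, injective u}.
  move=> x y Px Py uxy; apply/val_inj/(small_dvdz_inj _ _ _ (ltn_ord x) (ltn_ord y)).
  by apply: inverse_unique (uP x Px) _; rewrite uxy; apply: uP.
have cardP : (#|P| <= 3 * Z)%N.
  rewrite -sum1_card.
  pose zs : seq int := [seq i%:Z - Z%:Z | i <- iota 0 (2 * Z).+1].
  apply: (@leq_trans (\sum_(z <- zs) 1)%N).
    apply: (leq_sum_inj _ _ P u (fun=> 1%N)) => // x Px; apply/mapP.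
    have := uZ x Px => ux; exists (absz (u x + Z%:Z)); last by clear -ux; lia.
    by rewrite mem_iota; clear -ux; lia.
  by rewrite sum1_size size_map size_iota; clear -Z0; lia.
rewrite (bigD1 0) //= mulnDr.
have first_le : (p.+1 * #|[pred x | P x && P (0 - x)%R]| ^ 2 <= p.+1 * (3 * Z) ^ 2)%N.
  rewrite leq_mul2l leq_exp2r //=; apply: leq_trans cardP; apply: subset_leq_card.
  by apply/subsetP => x /andP[].
pose m (x c : 'I_p.+1) := u x + u (c - x).
have dvd_m g (x c : 'I_p.+1) : P x -> P (c - x) -> (g %| p.+1)%N ->
    (g %| m x c)%Z = (g %| (c : nat)%:Z)%Z.
  move=> Px Pc gq; have {}gq : (g%:Z %| p.+1%:Z)%Z by rewrite dvdzE.
  apply: (reciprocal_sum_dvdz g c x (c - x : 'I_p.+1)); apply: dvdz_trans gq _.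
  - exact: uP.
  - exact: uP.
  - exact: dvdz_ord_subr.
(* For fixed [x], [c] maps injectively to [m x c], a nonzero integer of size at most [2 Z] divisible
   by [gcd(c, q)]; so the gcds are summed over signed integers up to [2 Z]. *)
have inner x : P x ->
    (\sum_(c | (c != 0%R) && P (c - x)%R) gcdn c p.+1 <= 4 * Z * D)%N.
  move=> Px.
  pose zs := [seq i%:Z | i <- index_iota 1 (2 * Z).+1]
          ++ [seq - i%:Z | i <- index_iota 1 (2 * Z).+1].
  apply: (@leq_trans (\sum_(c | (c != 0%R) && P (c - x)%R) gcdn `|m x c| p.+1)%N).
    apply: leq_sum => c /andP[c0 Pc]; apply: dvdn_leq.
      by rewrite gcdn_gt0 orbT.
    rewrite dvdn_gcd dvdn_gcdr andbT.
    by have := dvd_m (gcdn c p.+1) x c Px Pc (dvdn_gcdr _ _); rewrite !dvdzE /= dvdn_gcdl.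
  apply: (@leq_trans (\sum_(z <- zs) gcdn `|z| p.+1)%N).
    apply: (leq_sum_inj _ _ [pred c | (c != 0) && P (c - x)] (m x)
              (fun z => gcdn `|z| p.+1)).
      move=> c c' /andP[_ Pc] /andP[_ Pc'] /addrI/uinj; move/(_ Pc Pc').
      exact: addIr.
    move=> c /andP[c0 Pc].
    have mN0 : m x c != 0.
      apply: contraNneq c0 => m0.
      have := dvd_m p.+1 x c Px Pc (dvdnn _); rewrite m0 dvdz0 dvdzE /=.
      move=> /esym; case: (posnP c) => [c0 _|c0 /(dvdn_leq c0)].
        by apply/eqP/val_inj.
      by rewrite leqNgt ltn_ord.
    have mle : (`|m x c| <= 2 * Z)%N.
      by rewrite mul2n -addnn; apply: leq_trans (abszD_le _ _) _; rewrite leq_add ?uZ.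
    rewrite mem_cat; apply/orP.
    case: (ler0P (m x c)) => h; [right|left]; apply/mapP; exists `|m x c|%N;
      rewrite ?mem_index_iota; clear -h mle mN0; move: (m x c) h mle mN0 => v; lia.
  rewrite big_cat !big_map /=.
  under [X in (_ + X)%N]eq_bigr do rewrite abszN.
  rewrite addnn -mul2n.
  have := sum_gcdn_le p.+1 (2 * Z) (ltn0Sn p).
  have h1 : (size (divisors p.+1) <= D)%N.
    apply: hD; rewrite /= (_ : (4 * p.+1 ^ 4 = p.+1 * (4 * p.+1 ^ 3))%N); last by rewrite expnS; ring.
    by rewrite leq_pmulr.
  move=> h2; rewrite (_ : (4 * Z * D = 2 * (D * (2 * Z)))%N); last ring.
  by rewrite leq_mul2l /=; apply: leq_trans h2 _; rewrite leq_mul2r h1 orbT.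
pose M := (24 * D * (p.+1 + Z * s))%N.
have rest : (p.+1 * \sum_(c | c != 0%R) #|[pred x | P x && P (c - x)%R]| ^ 2
    <= M * (#|P| * (4 * Z * D)))%N.
  rewrite big_distrr /=.
  apply: (@leq_trans (\sum_(c | c != 0%R) \sum_(x | P x && P (c - x)%R) M * gcdn c p.+1)%N).
    apply: leq_sum => c c0; rewrite sum_nat_const -mulnn mulnA mulnC leq_mul2l.
    apply/orP; right; apply: leq_trans (reciprocal_fiber_bound p P u Z s D c uP uZ Zq sZ hD c0) _.
    by rewrite leq_eqVlt; apply/orP; left; apply/eqP; rewrite /M; ring.
  rewrite (exchange_big_dep P) /=; last by move=> c x _ /andP[].
  rewrite -sum_nat_const big_distrr /=; apply: leq_sum => x Px.
  rewrite -big_distrr leq_mul2l; apply/orP; right.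
  by under eq_bigl do rewrite [P x]Px; apply: inner.
apply: leq_trans (leq_add first_le rest) _.
apply: (@leq_trans (p.+1 * (3 * Z) ^ 2 + M * (3 * Z * (4 * Z * D)))).
  by rewrite leq_add2l leq_mul2l leq_mul2r cardP !orbT.
have -> : (M * (3 * Z * (4 * Z * D)) = 288 * D ^ 2 * (Z ^ 2 * (p.+1 + Z * s)))%N.
  by rewrite /M; ring.
have -> : (p.+1 * (3 * Z) ^ 2 = 9 * (Z ^ 2 * p.+1))%N by ring.
set W := (Z ^ 2 * (p.+1 + Z * s))%N.
(* [300 = 12 + 288]: the [12] absorbs the [9] from [c = 0], the [288] comes from the other
   classes. *)
have -> : (300 * D ^ 2 * W = 12 * (D ^ 2 * W) + 288 * D ^ 2 * W)%N by ring.
rewrite leq_add2r; apply: leq_mul => //.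
apply: (@leq_trans W); last by rewrite leq_pmull // expn_gt0 D0.
by rewrite leq_mul2l leq_addr orbT.
Qed.

(** * Cauchy-Schwarz inequalities *)

(** Lagrange's identity: the double sum of [w_i w_j (f_i g_j - f_j g_i)^2] is twice the difference
    of the two sides. *)
Lemma weighted_cauchy_schwarz (R : realFieldType) (I : finType) (P : {pred I})
    (w f g : I -> R) : (forall i, P i -> 0 <= w i) ->
  (\sum_(i | P i) w i * f i * g i) ^+ 2
    <= (\sum_(i | P i) w i * f i ^+ 2) * (\sum_(i | P i) w i * g i ^+ 2).
Proof.
move=> w0.
have : 0 <= \sum_(i | P i) \sum_(j | P j) w i * w j * (f i * g j - f j * g i) ^+ 2.
  apply: sumr_ge0 => i Pi; apply: sumr_ge0 => j Pj.
  by rewrite mulr_ge0 ?sqr_ge0 // mulr_ge0 ?w0.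
set X := \sum_(i | P i) w i * f i ^+ 2; set Y := \sum_(i | P i) w i * g i ^+ 2.
set Z := \sum_(i | P i) w i * f i * g i.
have -> : \sum_(i | P i) \sum_(j | P j) w i * w j * (f i * g j - f j * g i) ^+ 2
    = \sum_(i | P i) (w i * f i ^+ 2 * Y + w i * g i ^+ 2 * X
                      - 2 * (w i * f i * g i * Z)).
  apply: eq_bigr => i _; rewrite /X /Y /Z !mulr_sumr -big_split -sumrB /=.
  by apply: eq_bigr => j _; ring.
rewrite sumrB big_split /= -!mulr_suml -mulr_sumr -mulr_suml -/X -/Y -/Z => h.
by rewrite -subr_ge0; nra.
Qed.

(** Cauchy-Schwarz with weights [a], squared, then Cauchy-Schwarz on the sum of [a b^2]. With
    [a = |alpha|] the first two factors become the squared norms of the weights. *)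
Lemma sum_mul_exp4_le (R : realFieldType) (I : finType) (P : {pred I}) (a b : I -> R) :
  (forall i, P i -> 0 <= a i) ->
  (\sum_(i | P i) a i * b i) ^+ 4 <=
    (\sum_(i | P i) a i) ^+ 2 * (\sum_(i | P i) a i ^+ 2) * (\sum_(i | P i) b i ^+ 4).
Proof.
move=> a0.
have h1 := weighted_cauchy_schwarz R I P a (fun=> 1) b a0.
have h2 := weighted_cauchy_schwarz R I P (fun=> 1) a (fun i => b i ^+ 2) (fun _ _ => ler01).
have e1 : \sum_(i | P i) a i * 1 * b i = \sum_(i | P i) a i * b i.
  by apply: eq_bigr => i _; rewrite mulr1.
have e2 : \sum_(i | P i) a i * 1 ^+ 2 = \sum_(i | P i) a i.
  by apply: eq_bigr => i _; rewrite expr1n mulr1.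
have e3 : \sum_(i | P i) 1 * a i * b i ^+ 2 = \sum_(i | P i) a i * b i ^+ 2.
  by apply: eq_bigr => i _; rewrite mul1r.
have e4 : \sum_(i | P i) 1 * a i ^+ 2 = \sum_(i | P i) a i ^+ 2.
  by apply: eq_bigr => i _; rewrite mul1r.
have e5 : \sum_(i | P i) 1 * (b i ^+ 2) ^+ 2 = \sum_(i | P i) b i ^+ 4.
  by apply: eq_bigr => i _; rewrite mul1r -exprM.
rewrite e1 e2 in h1; rewrite e3 e4 e5 in h2.
rewrite (exprM _ 2 2).
apply: (@le_trans _ _ (((\sum_(i | P i) a i) * (\sum_(i | P i) a i * b i ^+ 2)) ^+ 2)).
  by rewrite ler_pXn2r // ?nnegrE ?sqr_ge0 //; apply: le_trans h1; rewrite sqr_ge0.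
by rewrite exprMn -mulrA ler_wpM2l ?sqr_ge0.
Qed.

(** * Complex absolute value, additive characters and geometric sums *)

Lemma normcE_re (R : realType) (z : R[i]) : `|z| = (Normc.normc z)%:C.
Proof. by []. Qed.

Lemma normc_ge0 (R : realType) (z : R[i]) : 0 <= Normc.normc z.
Proof. by rewrite -lecR -normcE_re normr_ge0. Qed.

Lemma normcN (R : realType) (z : R[i]) : Normc.normc (- z) = Normc.normc z.
Proof. by have [] : (Normc.normc (- z))%:C = (Normc.normc z)%:C by rewrite -!normcE_re normrN. Qed.

Lemma normc_sum (R : realType) (I : Type) (r : seq I) (P : pred I) (F : I -> R[i]) :
  Normc.normc (\sum_(i <- r | P i) F i) <= \sum_(i <- r | P i) Normc.normc (F i).
Proof.
rewrite -lecR rmorph_sum /= -normcE_re; apply: le_trans (ler_norm_sum _ _ _) _.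
by rewrite le_eqVlt; apply/orP; left; apply/eqP/eq_bigr.
Qed.

Lemma normc_sqr (R : realType) (z : R[i]) : (Normc.normc z ^+ 2)%:C = z * z^*.
Proof. by rewrite rmorphXn /= -normcE_re sqr_normc. Qed.


Lemma normcB_le (R : realType) (z w : R[i]) :
  Normc.normc (z - w) <= Normc.normc z + Normc.normc w.
Proof. by rewrite -lecR rmorphD /= -!normcE_re ler_normB. Qed.

Lemma e_qD (R : realType) q z1 z2 : e_q R q (z1 + z2) = e_q R q z1 * e_q R q z2.
Proof.
rewrite /e_q /= intrD mulrDr mulrDl.
set a := 2 * pi * z1%:~R / q%:R; set b := 2 * pi * z2%:~R / q%:R.
rewrite cosD sinD; apply/eqP.
by rewrite eq_complex /= eqxx /= addrC.
Qed.

Lemma e_q0 (R : realType) q : e_q R q 0 = 1.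
Proof. by rewrite /e_q mulr0 mul0r cos0 sin0. Qed.

Lemma e_qM (R : realType) q z (n : nat) : e_q R q (n%:Z * z) = e_q R q z ^+ n.
Proof.
elim: n => [|n IH]; first by rewrite mul0r e_q0.
rewrite exprS -IH -e_qD; congr (e_q _ q _); lia.
Qed.

Lemma normc_e_q (R : realType) q z : Normc.normc (e_q R q z) = 1.
Proof. by rewrite /e_q /Normc.normc cos2Dsin2 sqrtr1. Qed.

Lemma e_q_conj (R : realType) q z : ((e_q R q z)^*)%R = e_q R q (- z).
Proof.
by rewrite /e_q /= intrN mulrN mulNr cosN sinN.
Qed.

Lemma e_q_period (R : realType) (q : nat) (z1 z2 : int) : (0 < q)%N ->
  (q %| z1 - z2)%Z -> e_q R q z1 = e_q R q z2.
Proof.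
move=> q0 /dvdzP[k hk].
have eqq : e_q R q q%:Z = 1.
  rewrite /e_q /= mulfK ?pnatr_eq0 -?lt0n //.
  by rewrite mulrC mulr_natr cos2pi sin2pi.
have enq (n : nat) : e_q R q (n%:Z * q%:Z) = 1 by rewrite e_qM eqq expr1n.
have e1 : e_q R q (k * q%:Z) = 1.
  case: k {hk} => n; first exact: enq.
  rewrite -[LHS]mulr1 -{1}(enq n.+1) -e_qD NegzE.
  by rewrite (_ : _ + _ = 0) ?e_q0 //; ring.
by rewrite -(subrK z2 z1) hk e_qD e1 mul1r.
Qed.

Lemma normc1B_e_qN (R : realType) (q : nat) (z : int) :
  Normc.normc (1 - e_q R q (- z)) = Normc.normc (1 - e_q R q z).
Proof.
have -> : 1 - e_q R q (- z) = - e_q R q (- z) * (1 - e_q R q z).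
  by rewrite mulrBr mulr1 mulNr opprK -e_qD addNr e_q0 addrC.
by rewrite Normc.normcM normcN normc_e_q mul1r.
Qed.

Lemma normc1B_e_qM (R : realType) (q k : nat) (z : int) :
  Normc.normc (1 - e_q R q (k%:Z * z)) <= k%:R * Normc.normc (1 - e_q R q z).
Proof.
rewrite e_qM -{1}(expr1n _ k) subrXX Normc.normcM mulrC.
rewrite ler_wpM2r ?normc_ge0 //; apply: le_trans (normc_sum _ _ _ _ _) _.
rewrite -[X in _ <= X%:R]card_ord -sumr_const; apply: ler_sum => i _.
by rewrite expr1n mul1r -e_qM normc_e_q.
Qed.

(** The angle lies between [pi / 2] and [pi], where the cosine is at most 0. *)
Lemma normc1B_e_q_quarter (R : realType) (q y : nat) :
  (0 < q)%N -> (q <= 4 * y)%N -> (2 * y <= q)%N ->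
  1 <= Normc.normc (1 - e_q R q y%:Z).
Proof.
move=> q0 h1 h2; set a : R := 2 * pi * (y%:Z)%:~R / q%:R.
have qR : 0 < q%:R :> R by rewrite ltr0n.
have pi0 := pi_gt0 R.
have ca : cos a <= 0.
  rewrite -(subrK (pi / 2) a) cosDpihalf oppr_le0 sin_ge0_pi //.
  have {}h1 : q%:R <= 4 * y%:R :> R by rewrite -natrM ler_nat.
  have {}h2 : 2 * y%:R <= q%:R :> R by rewrite -natrM ler_nat.
  have aE : a * q%:R = 2 * pi * y%:R by rewrite /a divfK // gt_eqF.
  by apply/andP; split; nra.
rewrite /e_q -/a /Normc.normc /= -[X in X <= _]sqrtr1 ler_wsqrtr //.
by have := cos2Dsin2 a; nra.
Qed.

(** Some multiple [k y] lies between [q / 4] and [q / 2], so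
    [1 <= |1 - e_q (k y)| <= k |1 - e_q y|], while [k y <= q]. *)
Lemma normc1B_e_q_ge (R : realType) (q y : nat) : (0 < y)%N -> (2 * y <= q)%N ->
  y%:R <= q%:R * Normc.normc (1 - e_q R q y%:Z).
Proof.
move=> y0 yq; have q0 : (0 < q)%N by lia.
have [k [k1 k2]] : exists k, (q <= 4 * (k * y))%N /\ (2 * (k * y) <= q)%N.
  have [h|h] := leqP q (4 * y); first by exists 1%N; rewrite mul1n.
  exists (q %/ (4 * y)).+1.
  have h1 : (q < (q %/ (4 * y)).+1 * (4 * y))%N by apply: ltn_ceil; lia.
  have h2 := leq_divM q (4 * y).
  by move: (q %/ (4 * y))%N h1 h2 => m h1 h2; split; nia.
have h := normc1B_e_q_quarter R q (k * y) q0 k1 k2.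
rewrite PoszM in h; have {}h := le_trans h (normc1B_e_qM _ _ _ _).
have nc0 := normc_ge0 R (1 - e_q R q y%:Z).
have {}k2 : k%:R * y%:R <= q%:R :> R by rewrite -natrM ler_nat; lia.
move: (Normc.normc _) h nc0 => E h nc0.
apply: (@le_trans _ _ (k%:R * y%:R * E)); last by rewrite ler_wpM2r.
by rewrite mulrAC -[X in X <= _]mul1r ler_wpM2r.
Qed.

(** Multiplying the sum by [1 - e_q y] telescopes it to a difference of two numbers of modulus 1;
    then the lower bound for [|1 - e_q y|] applies. *)
Lemma geometric_sum_e_q (R : realType) (q : nat) (y : int) (L N : nat) :
  (0 < `|y|)%N -> (2 * `|y| <= q)%N ->
  Normc.normc (\sum_(L.+1 <= n < (L + N).+1) e_q R q (n%:Z * y)) * `|y|%:R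
    <= 2 * q%:R.
Proof.
move=> y0 yq; set S := \sum_(_ <= n < _) _.
have abs1 : Normc.normc (1 - e_q R q y) = Normc.normc (1 - e_q R q `|y|%N%:Z).
  have [{1}->|{1}->] : y = `|y|%N%:Z \/ y = - `|y|%N%:Z by lia.
    by [].
  exact: normc1B_e_qN.
have tele : S * (1 - e_q R q y) = e_q R q (L.+1%:Z * y) - e_q R q ((L + N).+1%:Z * y).
  rewrite /S mulr_suml (telescope_sumr_eq (fun n => - e_q R q (n%:Z * y))).
  - by rewrite opprK addrC.
  - by rewrite ltnS leq_addr.
  - move=> n _; rewrite opprK mulrBr mulr1 -e_qD [RHS]addrC; congr (_ - e_q _ _ _).
    by rewrite intS mulrDl mul1r addrC.
have S2 : Normc.normc S * Normc.normc (1 - e_q R q `|y|%N%:Z) <= 2.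
  rewrite -abs1 -Normc.normcM tele; apply: le_trans (normcB_le _ _ _) _.
  by rewrite !normc_e_q.
have h := normc1B_e_q_ge R q `|y| y0 yq; have a0 := normc_ge0 R S.
apply: le_trans (ler_wpM2l a0 h) _.
by rewrite mulrCA mulrC ler_wpM2r.
Qed.

Lemma sum_e_q (R : realType) (q : nat) (z : int) : (0 < q)%N ->
  \sum_(m < q) e_q R q ((m : nat)%:Z * z) = if (q %| z)%Z then q%:R else 0.
Proof.
move=> q0; case: ifPn => [qz|qNz].
  under eq_bigr => m _.
    rewrite (e_q_period R q _ 0) //; last by rewrite subr0 dvdz_mull.
    rewrite e_q0; over.
  by rewrite sumr_const card_ord.
have eN1 : 1 - e_q R q z != 0.
  pose y := (z %% q)%Z.
  have qZ : q%:Z != 0 by rewrite -absz_gt0.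
  have y0 : 0 < y.
    rewrite lt_neqAle modz_ge0 // andbT eq_sym.
    by apply: contra qNz => /eqP y0; apply/dvdz_mod0P.
  have yq : y < q%:Z by rewrite ltz_pmod.
  have -> : e_q R q z = e_q R q y.
    apply: e_q_period => //; rewrite /y {1}(divz_eq z q) addrK; exact: dvdz_mull.
  (* [w] is the distance from [y] to the nearest multiple of [q]; being at most [q / 2], it admits
     the lower bound for [|1 - e_q w|]. *)
  suff [w [w0 wq wE]] : exists w : nat,
      [/\ (0 < w)%N, (2 * w <= q)%N & e_q R q y = 1 -> e_q R q w%:Z = 1].
    apply/eqP => e1; have {}e1 : e_q R q y = 1 by apply/esym/subr0_eq.
    have := normc1B_e_q_ge R q w w0 wq.
    by rewrite (wE e1) subrr Normc.normc0 mulr0 lern0 -leqn0 leqNgt w0.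
  have [h|h] := leqP (2 * `|y|) q; first by exists `|y|%N; split; rewrite ?absz_gt0 ?gtz0_abs // ?gt_eqF.
  exists (q - `|y|)%N; split; [lia|lia|].
  have -> : (q - `|y|)%N%:Z = q%:Z - y by lia.
  move=> e1; have := e_qD R q (q%:Z - y) y; rewrite e1 mulr1 => <-.
  by rewrite subrK (e_q_period R q _ 0) ?e_q0 ?subr0.
have {}eN1 : e_q R q z - 1 != 0 by rewrite subr_eq0 eq_sym -subr_eq0.
apply: (mulfI eN1); under eq_bigr => m _ do rewrite e_qM.
rewrite mulr0 -subrX1 -e_qM (e_q_period R q _ 0) //.
  by rewrite e_q0 subrr.
by rewrite subr0 dvdz_mulr.
Qed.

(** * Parseval and the fourth moment *)

Lemma dvdz_subr_ord (p : nat) (x y : 'I_p.+1) :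
  (p.+1 %| (x : nat)%:Z - (y : nat)%:Z)%Z = (x == y).
Proof.
by rewrite -eqz_mod_dvd !modz_nat !modn_small.
Qed.

Lemma parseval_e_q (R : realType) (p : nat) (G : 'I_p.+1 -> R[i]) :
  \sum_(m < p.+1) Normc.normc (\sum_c G c * e_q R p.+1 ((m : nat)%:Z * (c : nat)%:Z)) ^+ 2
    = p.+1%:R * \sum_c Normc.normc (G c) ^+ 2.
Proof.
suff [] : (\sum_(m < p.+1) Normc.normc (\sum_c G c * e_q R p.+1 ((m : nat)%:Z * (c : nat)%:Z)) ^+ 2)%:C
    = (p.+1%:R * \sum_c Normc.normc (G c) ^+ 2)%:C by [].
rewrite rmorphM !rmorph_sum rmorph_nat /=.
under eq_bigr => m _.
  rewrite normc_sqr rmorph_sum mulr_suml.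
  under eq_bigr => c _.
    rewrite mulr_sumr.
    under eq_bigr => c' _.
      rewrite rmorphM /= e_q_conj mulrACA -e_qD -mulrBr.
      over.
    over.
  over.
rewrite exchange_big mulr_sumr; apply: eq_bigr => c _.
rewrite exchange_big (bigD1 c) //= [X in _ + X]big1 ?addr0.
  rewrite -mulr_sumr sum_e_q // subrr dvdz0 normc_sqr mulrC //.
move=> c' c'c; rewrite -mulr_sumr sum_e_q // dvdz_subr_ord eq_sym (negPf c'c).
by rewrite mulr0.
Qed.

(** The square of the exponential sum has as coefficients the additive convolution [G] of [gam] with
    itself. Parseval applies to [G], and [|G c|] is at most [B^2] times the number of
    representations of [c]. *)
Lemma fourth_moment_le (R : realType) (p : nat) (P : {pred 'I_p.+1})
    (gam : 'I_p.+1 -> R[i]) (B : R) :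
  (forall x, P x -> Normc.normc (gam x) <= B) ->
  (forall x, ~~ P x -> gam x = 0) ->
  \sum_(m < p.+1) Normc.normc (\sum_x gam x * e_q R p.+1 ((m : nat)%:Z * (x : nat)%:Z)) ^+ 4
    <= p.+1%:R * (B ^+ 4 * (\sum_c #|[pred x | P x && P (c - x)%R]| ^ 2)%N%:R).
Proof.
move=> gB g0.
pose G c := \sum_x gam x * gam (c - x).
have sq (m : 'I_p.+1) :
    (\sum_x gam x * e_q R p.+1 ((m : nat)%:Z * (x : nat)%:Z)) ^+ 2
    = \sum_c G c * e_q R p.+1 ((m : nat)%:Z * (c : nat)%:Z).
  under [RHS]eq_bigr => c _ do rewrite /G mulr_suml.
  rewrite exchange_big expr2 mulr_suml /=; apply: eq_bigr => x _.
  rewrite mulr_sumr (reindex_inj (addIr (- x))) /=; apply: eq_bigr => c _.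
  rewrite mulrACA -e_qD; congr (_ * _); apply: e_q_period => //.
  rewrite -mulrDr -mulrBr dvdz_mull //.
  exact: dvdz_ord_subr.
have e4 (z : R[i]) : Normc.normc z ^+ 4 = Normc.normc (z ^+ 2) ^+ 2.
  by rewrite [z ^+ 2]expr2 Normc.normcM -expr2 -exprM.
rewrite (eq_bigr (fun m : 'I_p.+1 => Normc.normc
    (\sum_c G c * e_q R p.+1 ((m : nat)%:Z * (c : nat)%:Z)) ^+ 2)); last first.
  by move=> m _; rewrite -sq; apply: e4.
rewrite parseval_e_q ler_wpM2l // natr_sum mulr_sumr; apply: ler_sum => c _.
(* An element of [P] also supplies [0 <= B]; with no representation, [G c = 0]. *)
have [n0|[x]] : #|[pred x | P x && P (c - x)%R]| = 0%N \/ exists x, P x && P (c - x)%R.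
    case: (pickP [pred x | P x && P (c - x)%R]) => [x h|h]; [right|left].
    by exists x.
  by apply: eq_card0 => x; apply: (h x).
- have G0 : G c = 0.
    apply: big1 => x _; have := card0_eq n0 x; rewrite inE => /negbT.
    by rewrite negb_and => /orP[|] /g0 ->; rewrite ?mul0r ?mulr0.
  by rewrite G0 Normc.normc0 n0 expr0n mulr0.
case/andP => Px _; have B0 : 0 <= B := le_trans (normc_ge0 _ _) (gB x Px).
have : Normc.normc (G c) <= B ^+ 2 * #|[pred x | P x && P (c - x)%R]|%:R.
  apply: le_trans (normc_sum _ _ _ _ _) _.
  rewrite (bigID (fun x => P x && P (c - x))) /= [X in _ + X]big1 ?addr0.
    rewrite mulr_natr -sumr_const; apply: ler_sum => y /andP[Py Pcy].
    by rewrite Normc.normcM expr2 ler_pM ?normc_ge0 ?gB.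
  move=> y; rewrite negb_and => /orP[|] /g0 ->; by rewrite ?mul0r ?mulr0 Normc.normc0.
move=> h; rewrite natrX (exprM B 2 2) -exprMn.
by rewrite ler_pXn2r // nnegrE ?normc_ge0 ?mulr_ge0 ?exprn_ge0.
Qed.

Lemma bilinear_exp4_le (R : realType) (p : nat) (U P : {pred 'I_p.+1})
    (alpha gam : 'I_p.+1 -> R[i]) (B : R) :
  (forall x, P x -> Normc.normc (gam x) <= B) ->
  (forall x, ~~ P x -> gam x = 0) ->
  Normc.normc (\sum_(m | U m) alpha m *
      \sum_x gam x * e_q R p.+1 ((m : nat)%:Z * (x : nat)%:Z)) ^+ 4
    <= (\sum_(m | U m) Normc.normc (alpha m)) ^+ 2
       * (\sum_(m | U m) Normc.normc (alpha m) ^+ 2)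
       * (p.+1%:R * (B ^+ 4 * (\sum_c #|[pred x | P x && P (c - x)%R]| ^ 2)%N%:R)).
Proof.
move=> gB g0; pose A (m : 'I_p.+1) :=
  \sum_x gam x * e_q R p.+1 ((m : nat)%:Z * (x : nat)%:Z).
apply: (@le_trans _ _ ((\sum_(m | U m) Normc.normc (alpha m) * Normc.normc (A m)) ^+ 4)).
  rewrite ler_pXn2r ?nnegrE ?normc_ge0 //; last first.
    by apply: sumr_ge0 => m _; rewrite mulr_ge0 ?normc_ge0.
  apply: le_trans (normc_sum _ _ _ _ _) _.
  by apply: ler_sum => m _; rewrite Normc.normcM.
apply: le_trans (sum_mul_exp4_le _ _ _ _ _ (fun _ _ => normc_ge0 _ _)) _.
apply: ler_wpM2l.
  by rewrite mulr_ge0 ?sqr_ge0 ?sumr_ge0 // => m _; rewrite sqr_ge0.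
apply: le_trans (fourth_moment_le R p P gam B gB g0).
(* By positivity the moment over [U] extends to all residues, as Parseval requires. *)
rewrite [X in _ <= X](bigID U) /= lerDl; apply: sumr_ge0 => m _.
by rewrite exprn_ge0 ?normc_ge0.
Qed.

(** * Dyadic shells of the inverse *)

(** The least absolute residue of the inverse of [x], in [(-q/2, q/2]]: its size controls the
    geometric sum over [n]. *)
Definition signed_inv (p : nat) (x : 'I_p.+1) : int :=
  let y : nat := Zp_inv x in
  if (2 * y <= p.+1)%N then y%:Z else y%:Z - p.+1%:Z.

Lemma signed_inv_congr (p : nat) (x : 'I_p.+1) :
  (p.+1 %| (Zp_inv x : nat)%:Z - signed_inv p x)%Z.
Proof.
rewrite /signed_inv /=; case: ifP => _; first by rewrite subrr dvdz0.
by rewrite opprB addrC subrK dvdzz.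
Qed.

Lemma signed_invP (p : nat) (x : 'I_p.+1) : x \in Zunits p.+1 ->
  (p.+1 %| (x : nat)%:Z * signed_inv p x - 1)%Z.
Proof.
move=> xU; have xV : (p.+1 %| (x : nat)%:Z * (Zp_inv x : nat)%:Z - 1)%Z.
  have /(congr1 val) /= xE := @Zunits_mulV p.+1 x isT xU.
  by rewrite -eqz_mod_dvd -PoszM !modz_nat xE.
have -> : (x : nat)%:Z * signed_inv p x - 1 = ((x : nat)%:Z * (Zp_inv x : nat)%:Z - 1)
   - (x : nat)%:Z * ((Zp_inv x : nat)%:Z - signed_inv p x) by ring.
by rewrite rpredB // dvdz_mull // signed_inv_congr.
Qed.

Lemma signed_inv_le (p : nat) (x : 'I_p.+1) : (2 * `|signed_inv p x| <= p.+1)%N.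
Proof.
rewrite /signed_inv /=; have := ltn_ord (Zp_inv x).
by move: (Zp_inv x : nat) => y; case: ifP; lia.
Qed.

Lemma signed_inv_gt0 (p : nat) (x : 'I_p.+1) : (0 < p)%N -> x \in Zunits p.+1 ->
  (0 < `|signed_inv p x|)%N.
Proof.
move=> p0 xU; rewrite absz_gt0; apply/eqP => u0.
have := signed_invP p x xU; rewrite u0 mulr0 sub0r dvdzE /= dvdn1.
by case: p p0 {x xU u0}.
Qed.

Lemma geometric_sum_signed_inv (R : realType) (p L N : nat) (x : 'I_p.+1) :
  \sum_(L.+1 <= n < (L + N).+1) e_q R p.+1 (n%:Z * (Zp_inv x : nat)%:Z)
  = \sum_(L.+1 <= n < (L + N).+1) e_q R p.+1 (n%:Z * signed_inv p x).
Proof.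
apply: eq_bigr => n _; apply: e_q_period => //.
by rewrite -mulrBr dvdz_mull // signed_inv_congr.
Qed.

Lemma bilinear_sumE (R : realType) (p L N : nat) (alpha : 'I_p.+1 -> R[i]) :
  bilinear_sum (q := p.+1) alpha L N =
  \sum_(m in Zunits p.+1) alpha m * \sum_(x in Zunits p.+1)
     (\sum_(L.+1 <= n < (L + N).+1) e_q R p.+1 (n%:Z * signed_inv p x))
     * e_q R p.+1 ((m : nat)%:Z * (x : nat)%:Z).
Proof.
apply: eq_bigr => m _; rewrite -mulr_sumr; congr (_ * _).
rewrite /kloosterman exchange_big; apply: eq_bigr => x _ /=.
rewrite -geometric_sum_signed_inv mulr_suml; apply: eq_bigr => n _.
by rewrite e_qD mulrC.
Qed.

(** [B^4 Z^2 q = B^2 (B Z)^2 q] is at most [N^2 (4 q)^2 q]. The square of [B^4 Z^3 s] is at most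
    [B (B Z)^7 q <= N (4 q)^7 q], using [s^2 <= Z q]. Thus [Z] disappears from the bound. *)
Lemma shell_arith (R : realType) (N q Z s B D J : R) :
  0 <= N -> 0 < q -> 0 <= Z -> 0 <= s -> 0 <= B -> B <= N -> B * Z <= 4 * q ->
  s ^+ 2 <= Z * q ->
  q * J <= 300 * D ^+ 2 * (Z ^+ 2 * (q + Z * s)) ->
  q * (B ^+ 4 * J) <=
    300 * D ^+ 2 * (128 * (N ^+ 2 * q ^+ 3 + Num.sqrt N * q ^+ 4)).
Proof.
move=> N0 q0 Z0 s0 B0 BN BZ sZ qJ.
have h1 : B ^+ 4 * (Z ^+ 2 * q) <= 16 * (N ^+ 2 * q ^+ 3).
  rewrite (_ : B ^+ 4 * _ = B ^+ 2 * (B * Z) ^+ 2 * q); last ring.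
  rewrite (_ : 16 * _ = N ^+ 2 * (4 * q) ^+ 2 * q); last ring.
  rewrite ler_wpM2r ?(ltW q0) // ler_pM ?exprn_ge0 ?mulr_ge0 //.
    by rewrite ler_pXn2r ?nnegrE.
  by rewrite ler_pXn2r ?nnegrE ?mulr_ge0 ?(ltW q0).
have h2 : B ^+ 4 * (Z ^+ 3 * s) <= 128 * (Num.sqrt N * q ^+ 4).
  rewrite -(@ler_pXn2r _ 2) ?nnegrE ?mulr_ge0 ?exprn_ge0 ?sqrtr_ge0 ?(ltW q0) //.
  apply: (@le_trans _ _ (B ^+ 8 * Z ^+ 6 * (Z * q))).
    rewrite (_ : (B ^+ 4 * _) ^+ 2 = B ^+ 8 * Z ^+ 6 * s ^+ 2); last ring.
    by rewrite ler_wpM2l ?mulr_ge0 ?exprn_ge0.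
  rewrite (_ : _ * (Z * q) = B * (B * Z) ^+ 7 * q); last ring.
  (* The constant is [128 = 4^(7/2)]. *)
  have -> : (128 * (Num.sqrt N * q ^+ 4)) ^+ 2 = N * (4 * q) ^+ 7 * q.
    have -> : (128 * (Num.sqrt N * q ^+ 4)) ^+ 2 = 128 ^+ 2 * Num.sqrt N ^+ 2 * q ^+ 8 by ring.
    by rewrite sqr_sqrtr //; ring.
  rewrite ler_wpM2r ?(ltW q0) // ler_pM ?exprn_ge0 ?mulr_ge0 //.
  by rewrite ler_pXn2r ?nnegrE ?mulr_ge0 ?(ltW q0).
have B4 : 0 <= B ^+ 4 by rewrite exprn_ge0.
have D2 := sqr_ge0 D.
have X0 : 0 <= N ^+ 2 * q ^+ 3 by rewrite mulr_ge0 ?exprn_ge0 // ltW.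
apply: (@le_trans _ _ (B ^+ 4 * (300 * D ^+ 2 * (Z ^+ 2 * (q + Z * s))))).
  by rewrite mulrCA ler_wpM2l.
have -> : B ^+ 4 * (300 * D ^+ 2 * (Z ^+ 2 * (q + Z * s))) =
   300 * D ^+ 2 * (B ^+ 4 * (Z ^+ 2 * q) + B ^+ 4 * (Z ^+ 3 * s)) by ring.
have c0 : 0 <= 300 * D ^+ 2 by rewrite mulr_ge0 ?ler0n.
apply: (ler_wpM2l c0); apply: le_trans (lerD h1 h2) _.
by rewrite [X in _ <= X]mulrDr lerD2r ler_wpM2r // ler_nat.
Qed.

Lemma shell_bound (R : realType) (p L N D j : nat) (alpha : 'I_p.+1 -> R[i]) :
  (0 < p)%N -> (j < trunc_log 2 p.+1)%N ->
  (forall n, (0 < n <= 4 * p.+1 ^ 4)%N -> (size (divisors n) <= D)%N) ->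
  Normc.normc (\sum_(m in Zunits p.+1) alpha m *
     \sum_x (if (x \in Zunits p.+1) && (trunc_log 2 `|signed_inv p x| == j) then
       \sum_(L.+1 <= n < (L + N).+1) e_q R p.+1 (n%:Z * signed_inv p x) else 0)
     * e_q R p.+1 ((m : nat)%:Z * (x : nat)%:Z)) ^+ 4
  <= (\sum_(m in Zunits p.+1) Normc.normc (alpha m)) ^+ 2
       * (\sum_(m in Zunits p.+1) Normc.normc (alpha m) ^+ 2)
       * (300 * D%:R ^+ 2 * (128 * (N%:R ^+ 2 * p.+1%:R ^+ 3
            + Num.sqrt N%:R * p.+1%:R ^+ 4))).
Proof.
move=> p0 jp hD.
pose P := [pred x : 'I_p.+1 | (x \in Zunits p.+1) && (trunc_log 2 `|signed_inv p x| == j)].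
pose F x := \sum_(L.+1 <= n < (L + N).+1) e_q R p.+1 (n%:Z * signed_inv p x).
pose gam (x : 'I_p.+1) := if P x then F x else 0.
pose Z := (2 ^ j.+1)%N.
have Z0 : (0 < Z)%N by rewrite expn_gt0.
have Zq : (Z <= p.+1)%N by apply: leq_trans (@trunc_logP 2 p.+1 isT isT); rewrite leq_exp2l.
have uZ x : P x -> (`|signed_inv p x| < Z)%N.
  by case/andP => _ /eqP jE; rewrite /Z -jE; apply: trunc_log_ltn.
have Zu x : P x -> (Z <= 2 * `|signed_inv p x|)%N.
  case/andP => xU /eqP jE; rewrite /Z expnS leq_mul2l /= -jE trunc_logP //.
  exact: signed_inv_gt0.
have [s sZ] := exists_sqrtn (Z * p.+1).
(* On the shell [|u| >= Z / 2], so the geometric bound [2 q / |u|] is at most [4 q / Z]. *)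
pose B : R := Num.min N%:R (4 * p.+1%:R / Z%:R).
have ZR : 0 < Z%:R :> R by rewrite ltr0n.
have gB x : P x -> Normc.normc (gam x) <= B.
  move=> Px; rewrite /gam Px le_min; apply/andP; split.
    apply: le_trans (normc_sum _ _ _ _ _) _.
    under eq_bigr => n _ do rewrite normc_e_q.
    by rewrite sumr_const_nat subSS addKn.
  rewrite ler_pdivlMr //.
  have xU : x \in Zunits p.+1 by case/andP: Px.
  have := geometric_sum_e_q R p.+1 (signed_inv p x) L N (signed_inv_gt0 p x p0 xU)
    (signed_inv_le p x).
  rewrite -/(F x) => h.
  apply: (@le_trans _ _ (Normc.normc (F x) * (2 * `|signed_inv p x|%N%:R))).
    by rewrite ler_wpM2l ?normc_ge0 // -natrM ler_nat Zu.
  have -> : 4 * p.+1%:R = 2 * (2 * p.+1%:R) :> R by ring.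
  by rewrite mulrCA ler_wpM2l.
have g0 x : ~~ P x -> gam x = 0 by rewrite /gam => /negPf ->.
have J := reciprocal_energy_bound p P (signed_inv p) Z s D.
have {}J := J (fun x Px => signed_invP p x (proj1 (andP Px))) (fun x Px => ltnW (uZ x Px)).
have {}J := J (introT andP (conj Z0 Zq)) sZ hD.
have {}J : p.+1%:R * (\sum_c #|[pred x | P x && P (c - x)%R]| ^ 2)%N%:R
    <= 300 * D%:R ^+ 2 * (Z%:R ^+ 2 * (p.+1%:R + Z%:R * s%:R)) :> R.
  by rewrite -!natrX -!natrM -natrD -!natrM ler_nat.
apply: le_trans (bilinear_exp4_le R p (mem (Zunits p.+1)) P alpha gam B gB g0) _.
apply: ler_wpM2l.
  by rewrite mulr_ge0 ?sqr_ge0 ?sumr_ge0 // => m _; rewrite sqr_ge0.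
apply: (shell_arith R N%:R p.+1%:R Z%:R s%:R B D%:R) J => //.
- by rewrite le_min ler0n divr_ge0 // mulr_ge0.
- by rewrite ge_min lexx.
- by rewrite -ler_pdivlMr // ge_min lexx orbT.
- by rewrite -natrX -natrM ler_nat; case/andP: sZ.
Qed.

(** * Bounds by small powers, and the splitting into shells *)

Lemma powR_bound_of_expn (R : realType) (eta : R) (k f M n : nat) :
  (0 < k)%N -> k%:R^-1 <= eta -> (0 < n)%N -> (f ^ k <= M * n)%N ->
  f%:R <= M%:R `^ k%:R^-1 * n%:R `^ eta.
Proof.
move=> k0 keta n0 fk; have k0' : k%:R != 0 :> R by rewrite pnatr_eq0 -lt0n.
have -> : f%:R = ((f ^ k)%N%:R) `^ k%:R^-1 :> R.
  by rewrite natrX -powR_mulrn ?ler0n // -powRrM mulfV // powRr1.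
apply: (@le_trans _ _ ((M * n)%N%:R `^ k%:R^-1)).
  by rewrite ge0_ler_powR ?nnegrE ?ler0n ?invr_ge0 ?ler_nat.
rewrite natrM powRM ?ler0n // ler_wpM2l ?powR_ge0 // ler_powR //.
by rewrite ler1n.
Qed.

Lemma exists_inv_le (R : realType) (eta : R) : 0 < eta ->
  exists k, (0 < k)%N /\ k%:R^-1 <= eta.
Proof.
move=> eta0; exists (Num.truncn eta^-1).+1; split=> //.
rewrite invf_ple ?posrE ?ltr0n //; apply: ltW.
by rewrite truncnS_gt.
Qed.

Lemma divisor_bound_powR (R : realType) (eta : R) : 0 < eta ->
  exists2 C : R, 0 < C &
    forall n, (0 < n)%N -> (size (divisors n))%:R <= C * n%:R `^ eta.
Proof.
move=> /exists_inv_le[k [k0 keta]].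
exists (((k ^ k) ^ (2 ^ k))%N%:R `^ k%:R^-1).
  by rewrite powR_gt0 // ltr0n !expn_gt0 k0.
by move=> n n0; apply: powR_bound_of_expn => //; apply: divisor_bound.
Qed.

Lemma trunc_log_powR (R : realType) (eta : R) : 0 < eta ->
  exists2 C : R, 0 < C &
    forall n, (0 < n)%N -> (trunc_log 2 n)%:R <= C * n%:R `^ eta.
Proof.
move=> /exists_inv_le[k [k0 keta]]; exists ((k ^ k)%N%:R `^ k%:R^-1).
  by rewrite powR_gt0 // ltr0n !expn_gt0 k0.
move=> n n0; apply: powR_bound_of_expn => //.
apply: (@leq_trans ((trunc_log 2 n).+1 ^ k)); first by rewrite leq_exp2r.
apply: leq_trans (succn_expn_le _ _ k0) _.
by rewrite leq_mul2l trunc_logP ?orbT.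
Qed.

(** For [q > 1] the signed inverse [u] of a unit is nonzero, and [2 |u| <= q] makes its binary
    logarithm smaller than that of [q], so each unit lies in exactly one shell. *)
Lemma bilinear_sum_shells (R : realType) (p L N : nat) (alpha : 'I_p.+1 -> R[i]) :
  (0 < p)%N ->
  bilinear_sum (q := p.+1) alpha L N =
  \sum_(j < trunc_log 2 p.+1) \sum_(m in Zunits p.+1) alpha m *
     \sum_x (if (x \in Zunits p.+1) && (trunc_log 2 `|signed_inv p x| == j) then
       \sum_(L.+1 <= n < (L + N).+1) e_q R p.+1 (n%:Z * signed_inv p x) else 0)
     * e_q R p.+1 ((m : nat)%:Z * (x : nat)%:Z).
Proof.
move=> p0; rewrite bilinear_sumE exchange_big; apply: eq_bigr => m _ /=.
rewrite -mulr_sumr; congr (_ * _); rewrite exchange_big big_mkcond /=.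
apply: eq_bigr => x _; case: ifPn => xU; last by rewrite big1 // => j _; rewrite mul0r.
have jlt : (trunc_log 2 `|signed_inv p x| < trunc_log 2 p.+1)%N.
  apply: trunc_log_max => //; apply: leq_trans (signed_inv_le p x).
  by rewrite expnS leq_mul2l trunc_logP ?signed_inv_gt0.
rewrite (bigD1 (Ordinal jlt)) //= eqxx [X in _ + X]big1 ?addr0 // => j jN.
rewrite ifN ?mul0r //; apply: contraNneq jN => jE.
by apply/eqP/val_inj; rewrite /= jE.
Qed.

(** * Norms, exponents and constants *)

Lemma weight_norm1E (R : realType) (q : nat) (alpha : Zmod q -> R[i]) :
  weight_norm 1 alpha = \sum_(m in Zunits q) Normc.normc (alpha m).
Proof.
rewrite /weight_norm invr1 powRr1; last by apply: sumr_ge0 => m _; rewrite powR_ge0.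
by apply: eq_bigr => m _; rewrite powRr1 ?normc_ge0.
Qed.

Lemma weight_norm2_sqr (R : realType) (q : nat) (alpha : Zmod q -> R[i]) :
  weight_norm 2 alpha ^+ 2 = \sum_(m in Zunits q) Normc.normc (alpha m) ^+ 2.
Proof.
have s0 : 0 <= \sum_(m in Zunits q) Normc.normc (alpha m) `^ 2.
  by apply: sumr_ge0 => m _; rewrite powR_ge0.
rewrite /weight_norm powR12_sqrt // sqr_sqrtr //.
by apply: eq_bigr => m _; rewrite powR_mulrn ?normc_ge0.
Qed.

Lemma powR_half_exp4 (R : realType) (x : R) : 0 <= x -> (x `^ (1 / 2)) ^+ 4 = x ^+ 2.
Proof.
by move=> x0; rewrite -powR_mulrn ?powR_ge0 // -powRrM -powR_mulrn //; congr (_ `^ _); lra.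
Qed.

Lemma exp4_add_le (R : realFieldType) (x y : R) : 0 <= x -> 0 <= y ->
  x ^+ 4 + y ^+ 4 <= (x + y) ^+ 4.
Proof.
move=> x0 y0; rewrite -subr_ge0.
rewrite (_ : _ - _ = 4 * (x ^+ 3 * y) + 6 * (x ^+ 2 * y ^+ 2) + 4 * (x * y ^+ 3)); last ring.
by rewrite !addr_ge0 // mulr_ge0 // mulr_ge0 ?exprn_ge0.
Qed.

(** With [N = a^8] and [q = b^4] the left side is [(a^4 b^3)^4 + (a b^4)^4], and the right side is
    the fourth power of the sum of the same two terms. *)
Lemma main_term_exp4_ge (R : realType) (N q : R) : 0 <= N -> 0 <= q ->
  N ^+ 2 * q ^+ 3 + Num.sqrt N * q ^+ 4
    <= (N `^ (1 / 8) * q + N `^ (1 / 2) * q `^ (3 / 4)) ^+ 4.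
Proof.
move=> N0 q0; set a := N `^ (1 / 8); pose b := q `^ (1 / 4).
have a0 : 0 <= a by apply: powR_ge0.
have b0 : 0 <= b by apply: powR_ge0.
have Na (k : nat) : N `^ (k%:R / 8) = a ^+ k.
  by rewrite -powR_mulrn // -powRrM; congr (_ `^ _); lra.
have qb (k : nat) : q `^ (k%:R / 4) = b ^+ k.
  by rewrite -powR_mulrn // -powRrM; congr (_ `^ _); lra.
have hN : N = a ^+ 8 by rewrite -Na divff ?powRr1 // pnatr_eq0.
have hq : q = b ^+ 4 by rewrite -qb divff ?powRr1 // pnatr_eq0.
have h2 : N `^ (1 / 2) = a ^+ 4 by rewrite -Na; congr (_ `^ _); lra.
have hs : Num.sqrt N = a ^+ 4 by rewrite -powR12_sqrt // -h2; congr (_ `^ _); lra.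
have h34 : q `^ (3 / 4) = b ^+ 3 by rewrite qb.
rewrite hs h2 h34 -/a; move: (a) (b) a0 b0 hN hq => {Na qb hs h2 h34} {a b} a b a0 b0 -> ->.
rewrite (_ : (a ^+ 8) ^+ 2 * _ = (a ^+ 4 * b ^+ 3) ^+ 4); last ring.
rewrite (_ : a ^+ 4 * (b ^+ 4) ^+ 4 = (a * b ^+ 4) ^+ 4); last ring.
by rewrite addrC exp4_add_le ?mulr_ge0 ?exprn_ge0.
Qed.

(** Numerically, [300 * 128 = 38400 <= 38416 = 14^4]. *)
Lemma shell_constant_le (R : realFieldType) (D x E F : R) :
  0 <= D -> D <= x -> 0 <= E -> E <= F ->
  300 * D ^+ 2 * (128 * E) <= 14 ^+ 4 * x ^+ 2 * F.
Proof.
move=> D0 Dx E0 EF; rewrite mulrCA mulrA mulrA.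
apply: ler_pM => //; first by rewrite !mulr_ge0 ?exprn_ge0 ?ler0n.
apply: ler_pM; rewrite ?mulr_ge0 ?exprn_ge0 ?ler0n //.
  by rewrite -natrM -natrX ler_nat.
by rewrite ler_pXn2r ?nnegrE // (le_trans D0).
Qed.

(** * Summation over the shells *)

Theorem theorem2p1 (R : realType) (delta : R) (hdelta : 0 < delta) :
  exists C : R, 0 < C /\
    forall (q L N : nat) (alpha : Zmod q -> R[i]),
      (1 <= q)%N ->
      (L + N <= q - 1)%N ->
      Normc.normc (bilinear_sum alpha L N) <=
        C * ((weight_norm 1 alpha * weight_norm 2 alpha) `^ (1 / 2)
             * (N%:R `^ (1 / 8) * q%:R + N%:R `^ (1 / 2) * q%:R `^ (3 / 4))
             * q%:R `^ delta).
Proof.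
(* Divisor counts up to [4 q^4] cost [q^delta], but only their square root enters; the number of
   shells takes the other [q^(delta / 2)]. *)
have d4 : 4 * (delta / 4) = delta by rewrite mulrC divfK ?pnatr_eq0.
have d2 : delta / 2 + delta / 2 = delta by rewrite -splitr.
have [C1 C1gt0 logC] : exists2 C : R, 0 < C &
    forall n, (0 < n)%N -> (trunc_log 2 n)%:R <= C * n%:R `^ (delta / 2).
  by apply: trunc_log_powR; rewrite divr_gt0.
have [C2 C2gt0 divC] : exists2 C : R, 0 < C &
    forall n, (0 < n)%N -> (size (divisors n))%:R <= C * n%:R `^ (delta / 4).
  by apply: divisor_bound_powR; rewrite divr_gt0.
pose C3 := C2 * 4 `^ (delta / 4).
have C3gt0 : 0 < C3 by rewrite mulr_gt0 // powR_gt0.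
exists (14 * C1 * Num.sqrt C3); split.
  by rewrite mulr_gt0 ?sqrtr_gt0 // mulr_gt0.
case=> [//|p] L N alpha _ LN.
set Y := weight_norm 1 alpha * weight_norm 2 alpha.
have W20 : 0 <= weight_norm 2 alpha by apply: powR_ge0.
have W10 : 0 <= weight_norm 1 alpha by apply: powR_ge0.
have Y0 : 0 <= Y by apply: mulr_ge0 W10 W20.
set M := _ + _ * _ `^ (3 / 4).
have M0 : 0 <= M by rewrite addr_ge0 // mulr_ge0 ?powR_ge0.
set Q := p.+1%:R in M M0 *.
have Q0 : 0 <= Q by [].
(* For [q = 1] the interval is empty and the sum vanishes. *)
have [p0|p0] := posnP p.
  have N0 : N = 0%N by clear -p0 LN; lia.
  rewrite /bilinear_sum big1 ?Normc.normc0.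
    by rewrite !mulr_ge0 ?powR_ge0 ?sqrtr_ge0 ?(ltW C1gt0).
  by move=> m _; rewrite big_geq // N0 addn0.
pose x := C3 * Q `^ delta.
have x0 : 0 <= x by rewrite mulr_ge0 ?powR_ge0 ?(ltW C3gt0).
pose D := Num.truncn x.
have hD n : (0 < n <= 4 * p.+1 ^ 4)%N -> (size (divisors n) <= D)%N.
  case/andP => n0 nle; rewrite /D truncn_ge_nat //.
  apply: le_trans (divC n n0) _; rewrite /x /C3 -mulrA ler_wpM2l ?(ltW C2gt0) //.
  apply: (@le_trans _ _ ((4 * p.+1 ^ 4)%N%:R `^ (delta / 4))).
    by rewrite ge0_ler_powR ?nnegrE ?ler0n ?ler_nat ?divr_ge0 ?(ltW hdelta).
  rewrite natrM powRM ?ler0n // natrX -powR_mulrn // -powRrM.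
  by rewrite d4.
have Dx : D%:R <= x by rewrite /D truncn_le.
(* The fourth root of the bound for one shell, the same for all [j]: [D^2 <= x^2] gives
   [Num.sqrt x]. *)
pose X := 14 * Num.sqrt x * (Y `^ (1 / 2) * M).
have X0 : 0 <= X by rewrite !mulr_ge0 ?powR_ge0 ?sqrtr_ge0.
have shell (j : nat) (jp : (j < trunc_log 2 p.+1)%N) := shell_bound R p L N D j alpha p0 jp hD.
rewrite bilinear_sum_shells //; apply: le_trans (normc_sum _ _ _ _ _) _.
apply: (@le_trans _ _ (\sum_(j < trunc_log 2 p.+1) X)).
  apply: ler_sum => j _; rewrite -(@ler_pXn2r _ 4) ?nnegrE ?normc_ge0 //.
  apply: le_trans (shell j (ltn_ord j)) _.
  have <- := weight_norm2_sqr R p.+1 alpha.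
  have <- := weight_norm1E R p.+1 alpha.
  rewrite -exprMn -/Y /X.
  have -> : (14 * Num.sqrt x * (Y `^ (1 / 2) * M)) ^+ 4
     = 14 ^+ 4 * (Num.sqrt x ^+ 2) ^+ 2 * ((Y `^ (1 / 2)) ^+ 4 * M ^+ 4) by ring.
  rewrite sqr_sqrtr // powR_half_exp4 // [X in _ <= X]mulrCA ler_wpM2l ?sqr_ge0 //.
  apply: shell_constant_le => //; last exact: main_term_exp4_ge.
  by rewrite addr_ge0 ?mulr_ge0 ?exprn_ge0 ?sqrtr_ge0.
rewrite sumr_const card_ord -[X *+ _]mulr_natl.
apply: le_trans (ler_wpM2r X0 (logC p.+1 isT)) _.
rewrite /X /x sqrtrM ?(ltW C3gt0) // -(powR12_sqrt (powR_ge0 _ _)) -powRrM.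
rewrite -/Q.
have -> : Q `^ delta = Q `^ (delta / 2) * Q `^ (delta / 2).
  by rewrite -powRD; [rewrite d2|rewrite /Q pnatr_eq0 implybT].
by rewrite le_eqVlt; apply/orP; left; apply/eqP; ring.
Qed.
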